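(* Let $X,Y$ be real topological-linear spaces, $\Omega\subseteq X$ nonempty, $f:X\to Y$, and $\psi:Y\to\mathbb R$ a seminorm. Assume that $K\subseteq Y$ is a nontrivial, solid, convex cone, $\mathbb A(\cdot):=\mathbb R_+\cdot(f[\Omega]-f(\cdot))$ or $\mathbb A(\cdot):=\mathbb R_+\cdot(f[\Omega]+K-f(\cdot))$ on $\Omega$, $\bar x\in\mathrm{WEff}(\Omega\mid f,K)$, and $A:=\mathbb A(\bar x)$ is nontrivial and convex. Moreover, suppose that $B_K(\psi)$ and $B_A(\psi)$ are normlike-bases for $K$ and $A$, respectively, and $S_{-K}(\psi)$ is solid. Then there is $(x^*,\alpha)\in K^{a\circ}(\psi)$ such that, with $C:=C_\psi(x^*,\alpha)$, $\bar x\in\mathrm{WEff}(\Omega\mid f,C)$. Moreover, if $\operatorname{int}C\ne\emptyset$ and $\varphi:Y\to\mathbb R$ is a sublinear functional with $\varphi(0)=0$ which is $-C$ representing, then: (i) for any $k\in\operatorname{int}C$, $(\bar x,0)$ is a solution of $(P_\varphi^{a,k})$ for $a=f(\bar x)$; (ii) if $\varphi$ is strictly $-C$ representing (e.g. if $\varphi=\varphi_{x^*,\alpha}$ and $C^>_\psi(x^*,\alpha)\neq\emptyset$), then $\bar x\in\operatorname{argmin}_{x\in\Omega}\varphi(f(x)-f(\bar x))$; (iii) if $\mathcal P\subseteq Y$, $\mathcal T\subseteq\operatorname{int}C$, $\mathcal R\subseteq\mathbb R$ satisfy $f[\mathrm{WEff}(\Omega\mid f,C)]\subseteq\mathcal P+\mathcal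 R\cdot\mathcal T$, then there are $a\in\mathcal P$, $k\in\mathcal T$, $s\in\mathcal R$ so that $(\bar x,s)$ is a solution of $(P_\varphi^{a,k})$; (iv) if, in addition to the assumption in (iii), $C$ is closed and nontrivial, then there are $a\in\mathcal P$, $k\in\mathcal T$, $s\in\mathcal R$ so that $s=\varphi^G_{a-C,k}(f(\bar x))=\min_{x\in\Omega}\varphi^G_{a-C,k}(f(x))$.
   Context: $Y^*$ is the topological dual of $Y$, $\mathbb R_+=[0,\infty)$. A set $K\subseteq Y$ is a cone if $0\in K=\mathbb R_+\cdot K$; it is nontrivial if $\{0\}\ne K\ne Y$. A set is solid if its topological interior is nonempty. For a cone $M$: $B_M(\psi):=\{x\in M\mid\psi(x)=1\}$, $S_M(\psi):=\operatorname{conv}(B_M(\psi))$; $B_M(\psi)$ is a normlike-base for the nontrivial cone $M$ if $\psi>0$ on $M\setminus\{0\}$. $K^{a\circ}(\psi):=\{(x^*,\alpha)\in Y^*\times\mathbb R_+\mid\forall y\in\operatorname{int}K:\ x^*(y)-\alpha\psi(y)>0\}$. $C_\psi(x^*,\alpha):=\{y\in Y\mid x^*(y)\ge\alpha\psi(y)\}$, $C^>_\psi(x^*,\alpha):=\{y\in Y\mid x^*(y)>\alpha\psi(y)\}$, $\varphi_{x^*,\alpha}(y):=x^*(y)+\alpha\psi(y)$. $\varphi$ is $-C$ representing if $-C=\{y\in Y\mid\varphi(y)\le0\}$, and strictly $-C$ representing if in addition $-\operatorname{int}C=\{y\in Y\mid\varphi(y)<0\}$. For a cone $C$, $\mathrm{WEff}(\Omega\mid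 f,C)$ is the set of $\bar x\in\Omega$ for which there is no $x\in\Omega$ with $f(x)\in f(\bar x)-\operatorname{int}C$. $f[D]$ is the image of $D$. $(P_\varphi^{a,k})$ is the problem: minimize $\lambda$ subject to $\varphi(f(x)-a-\lambda k)\le0$, $(x,\lambda)\in\Omega\times\mathbb R$; a solution is a feasible pair with $\lambda$ minimal among all feasible pairs. $\varphi^G_{a-C,k}(y):=\inf\{t\in\mathbb R\mid y\in tk+(a-C)\}\in\mathbb R\cup\{\pm\infty\}$ ($\inf\emptyset=+\infty$). *)

(* Defs.v *)
From mathcomp Require Import all_boot all_order all_algebra.
From mathcomp Require Import boolp classical_sets functions reals ereal.
From mathcomp Require Import topology convex tvs.

Set Implicit Arguments.
Unset Strict Implicit.
Unset Printing Implicit Defensive.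

Import Order.TTheory GRing.Theory Num.Theory.
Import numFieldTopology.Exports.

Local Open Scope classical_set_scope.
Local Open Scope ring_scope.

(* [topologicalLmodType R] is the structure of real topological linear spaces:
   neither Hausdorff separation nor local convexity is required. *)
Section Definitions.
Context (R : realType) (X Y : topologicalLmodType R).
Implicit Types (K C M S : set Y) (psi phi : Y -> R) (Omega : set X)
  (f : X -> Y) (xs : {linear Y -> R^o}) (alpha : R).

Definition conical S : set Y :=
  [set t *: y | t in [set t : R | 0 <= t] & y in S].

Definition is_cone K : Prop := K 0 /\ K = conical K.

Definition nontrivial K : Prop := [set 0] <> K /\ K <> setT.

Definition solid S : Prop := S° !=set0.

Definition oppset S : set Y := [set - y | y in S].

Definition conv_hull S : set Y := smallest (@convex_set R Y) S.

Definition seminorm psi : Prop :=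
  (forall y z, psi (y + z) <= psi y + psi z) /\
  (forall (t : R) y, psi (t *: y) = `|t| * psi y).

Definition sublinear phi : Prop :=
  (forall y z, phi (y + z) <= phi y + phi z) /\
  (forall (t : R) y, 0 < t -> phi (t *: y) = t * phi y).

Definition base M psi : set Y := [set x | M x /\ psi x = 1].

Definition base_hull M psi : set Y := conv_hull (base M psi).

(* [base M psi] is a normlike-base of [M]; the notion is meant for a nontrivial
   cone [M]. *)
Definition normlike_base M psi : Prop :=
  forall x, M x -> x <> 0 -> 0 < psi x.

(* The topological dual of [Y] is represented by the continuous elements of
   [{linear Y -> R^o}]. *)
Definition augmented_dual K psi : set ({linear Y -> R^o} * R) :=
  [set p : {linear Y -> R^o} * R |
    [/\ continuous (p.1 : Y -> R^o), 0 <= p.2 &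
        forall y, K° y -> 0 < (p.1 y : R) - p.2 * psi y]].

Definition Cpsi psi xs alpha : set Y := [set y | alpha * psi y <= xs y].

Definition Cpsi_strict psi xs alpha : set Y := [set y | alpha * psi y < xs y].

Definition phi_sep psi xs alpha : Y -> R := fun y => xs y + alpha * psi y.

Definition representing C phi : Prop := oppset C = [set y | phi y <= 0].

Definition strictly_representing C phi : Prop :=
  representing C phi /\ oppset C° = [set y | phi y < 0].

Definition WEff Omega f C : set X :=
  [set xb | Omega xb /\
     ~ exists2 x, Omega x & [set f xb - c | c in C°] (f x)].

(* Minimize [lambda] subject to [phi (f x - a - lambda *: k) <= 0] over the
   pairs [(x, lambda)] with [x] in [Omega]. *)
Definition P_feasible Omega f phi (a k : Y) : set (X * R) :=
  [set p | Omega p.1 /\ phi (f p.1 - a - p.2 *: k) <= 0].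

Definition P_solution Omega f phi (a k : Y) : set (X * R) :=
  [set p | P_feasible Omega f phi a k p /\
     forall q, P_feasible Omega f phi a k q -> p.2 <= q.2].

Definition argmin Omega (g : X -> R) : set X :=
  [set xb | Omega xb /\ forall x, Omega x -> g xb <= g x].

(* [ereal_inf set0 = +oo]. *)
Definition phiG C (a k y : Y) : \bar R :=
  ereal_inf [set t%:E | t in [set t : R | [set t *: k + (a - c) | c in C] y]].

Definition is_min (S : set (\bar R)) (m : \bar R) : Prop :=
  S m /\ lbound S m.

End Definitions.

(* Main.v *)
(* The pair (x^*, alpha) can be taken with alpha = 0. Weak efficiency of xb says
   that the convex cone A misses -int K, so a continuous linear functional F is
   nonnegative on A and positive on int K. Then int (C_psi(F, 0)) = {F > 0}, a
   functional phi representing -C has the same sublevel set {phi <= 0} as F, and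
   all the scalarized problems reduce to F (f xb) <= F (f x) on Omega.
   For the separation, the convex cone U = A + int K does not contain 0. A
   maximal convex cone M disjoint from -U satisfies M union -M = Y, and for v in
   U the map y |-> sup {t | y - t v in M} is linear and positive on U; being
   bounded below on a solid set, it is continuous. *)
Require Import Defs.
From HB Require Import structures.
From mathcomp Require Import all_boot all_order all_algebra.
From mathcomp Require Import boolp classical_sets functions reals ereal.
From mathcomp Require Import topology convex tvs.
From mathcomp Require Import interval_inference.
From mathcomp Require Import lra.

Import Order.TTheory GRing.Theory Num.Theory.
Import numFieldTopology.Exports.

Local Open Scope classical_set_scope.
Local Open Scope ring_scope.

(** * Wedges and positive linear functionals on a real vector space *)

Definition wedge {R : realType} {V : lmodType R} (M : set V) : Prop :=
  (forall x y, M x -> M y -> M (x + y)) /\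
  (forall (t : R) x, 0 < t -> M x -> M (t *: x)).

(** Take [M] maximal among the wedges that miss [-U]. If neither [y] nor [- y] were in [M],
    adjoining either ray would meet [-U], and a positive combination of the two meeting points would
    cancel [y] and leave a point of [M] in [-U]. *)
Lemma exists_total_wedge {R : realType} {V : lmodType R} {U : set V} :
  wedge U -> ~ U 0 ->
  exists M : set V, [/\ wedge M, M 0, forall y, M y \/ M (- y) &
    forall y, M y -> ~ U (- y)].
Proof.
move=> [UD UZ] U0.
pose P (M : set V) := wedge M /\ forall y, M y -> ~ U (- y).
(* The empty chain causes no trouble: a wedge need not contain 0, so the empty set satisfies [P]. *)
have [|M [[[MD MZ] MU] Mmax]] := @Zorn_bigcup V P.
  move=> F FP Ftot; split; last by move=> y [N FN Ny]; exact: (FP _ FN).2.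
  split=> [x y [N FN Nx] [L FL Ly]|t x t0 [N FN Nx]].
    have [NL|LN] := Ftot _ _ FN FL.
      by exists L => //; apply: (FP _ FL).1.1 => //; exact: NL.
    by exists N => //; apply: (FP _ FN).1.1 => //; exact: LN.
  by exists N => //; exact: (FP _ FN).1.2.
have {}Mmax N : P N -> M `<=` N -> N `<=` M.
  by move=> PN MN; apply: contrapT => NM; apply: (Mmax N).
have M0 : M 0.
  apply: (Mmax [set y | M y \/ y = 0]); [|by left|by right].
  split=> [|y [/MU//|->]]; last by rewrite oppr0.
  split=> [x y|t x t0] /=.
    by move=> [Mx|->] [My|->]; rewrite ?addr0 ?add0r; auto.
  by move=> [Mx|->]; rewrite ?scaler0; auto.
have MZ0 (t : R) x : 0 <= t -> M x -> M (t *: x).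
  rewrite le_eqVlt => /orP[/eqP<-|t0]; first by rewrite scale0r.
  exact: MZ.
(* The wedge [M + R_+ y] contains [M] (take [t = 0]) and [y] (take [m = 0], by [M0]), so maximality
   applies as soon as it misses [-U]. *)
have Mext y : (forall m (t : R), M m -> 0 <= t -> ~ U (- (m + t *: y))) -> M y.
  move=> Uy.
  apply: (Mmax [set m + t *: y | m in M & t in [set t : R | 0 <= t]]).
  - split=> [|_ [m Mm [t t0 <-]]]; last exact: Uy.
    split=> [_ _ [m Mm [t /= t0 <-]] [n Mn [s /= s0 <-]]
            |t _ t0 [m Mm [s /= s0 <-]]].
      exists (m + n); first exact: MD.
      by exists (t + s); rewrite /= ?addr_ge0// scalerDl addrACA.
    exists (t *: m); first exact: MZ.
    by exists (t * s); rewrite /= ?mulr_ge0 ?(ltW t0)// scalerDr scalerA.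
  - by move=> m Mm; exists m => //; exists 0; rewrite /= ?scale0r ?addr0.
  - by exists 0 => //; exists 1; rewrite /= ?scale1r ?add0r.
exists M; split=> // y; apply: contrapT => /not_orP[My MNy].
have nonext z : ~ M z ->
    exists m (t : R), [/\ M m, 0 < t & U (- (m + t *: z))].
  move=> Mz; apply: contrapT => H; apply: Mz; apply: Mext => m t Mm.
  rewrite le_eqVlt => /orP[/eqP<-|t0 Umt].
    by rewrite scale0r addr0; exact: MU.
  by apply: H; exists m, t.
have [m [t [Mm t0 Umt]]] := nonext _ My.
have [n [s [Mn s0 Uns]]] := nonext _ MNy.
(* The weights [s] and [t] cancel [y] between [m + t *: y] and [n - s *: y]. *)
apply: (MU (s *: m + t *: n)); first by apply: MD; exact: MZ.
have := UD _ _ (UZ _ _ s0 Umt) (UZ _ _ t0 Uns).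
rewrite !scalerN -opprD !scalerDr !scalerN !scalerA (mulrC t s).
by rewrite addrACA subrr addr0.
Qed.

(** The last hypothesis is algebraic openness of [U]; it makes [u] absorb every direction, so the
    suprema are finite. Superadditivity comes from sums in [M], oddness from the totality of [M],
    and together they force additivity. *)
Lemma exists_pos_linear {R : realType} {V : lmodType R} {U : set V} {u : V} :
  wedge U -> ~ U 0 -> U u ->
  (forall x y, U x -> exists2 e : R, 0 < e & U (x + e *: y)) ->
  exists F : {linear V -> R^o}, forall x, U x -> 0 < (F x : R).
Proof.
move=> wU U0 Uu Uopen.
have [M [[MD MZ] M0 Mtot MU]] := exists_total_wedge wU U0.
have UM x : U x -> M x.
  by move=> Ux; have [//|/MU] := Mtot x; rewrite opprK.
pose S y := [set t : R | M (y - t *: u)].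
pose F (y : V) : R^o := sup (S y).
have Mle (s t : R) y : s <= t -> S y t -> S y s.
  rewrite /S /= le_eqVlt => /orP[/eqP->//|st Myt].
  suff -> : y - s *: u = (y - t *: u) + (t - s) *: u.
    by apply: MD => //; apply: MZ; [rewrite subr_gt0|exact: UM].
  by rewrite scalerBl addrA subrK.
have [lowS uppS] : (forall y, exists t, S y t) /\ (forall y, exists t, ~ S y t).
  have absorb y : exists2 t : R, 0 < t & U (y + t *: u).
    have [e e0 Ue] := Uopen u y Uu; exists e^-1; first by rewrite invr_gt0.
    have := wU.2 e^-1 _ _ Ue; rewrite invr_gt0 => /(_ e0).
    by rewrite scalerDr scalerA mulVf ?gt_eqF// scale1r addrC.
  split=> y.
    by have [t _ Ut] := absorb y; exists (- t); rewrite /S /= scaleNr opprK;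
      exact: UM.
  have [t _ Ut] := absorb (- y); exists t => /MU.
  by rewrite opprB addrC.
have ubS y t : ~ S y t -> ubound (S y) t.
  move=> nS s Ss; rewrite leNgt; apply/negP => /ltW ts.
  by apply: nS; exact: Mle Ss.
have hs y : has_sup (S y).
  split; first by have [t ?] := lowS y; exists t.
  by have [t ?] := uppS y; exists t; exact: ubS.
have SF y t : S y t -> t <= F y.
  by move=> ?; apply: ub_le_sup => //; exact: (hs y).2.
have FS y t : ~ S y t -> F y <= t.
  by move=> ?; apply: ge_sup; [exact: (hs y).1|exact: ubS].
have ltFS y (t : R) : t < F y -> S y t.
  by move=> tF; apply: contrapT => /FS; rewrite leNgt tF.
have F_super x y : (F x : R) + F y <= F (x + y).
  apply/ler_addgt0Pr => e e0.
  have e20 : 0 < e / 2 by rewrite divr_gt0.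
  have Sx := ltFS x (F x - e / 2) _; have Sy := ltFS y (F y - e / 2) _.
  suff /SF : S (x + y) (F x - e / 2 + (F y - e / 2)) by lra.
  rewrite /S /= scalerDl opprD addrACA.
  by apply: MD; [apply: Sx|apply: Sy]; rewrite ltrBlDr ltrDl.
have F0 : F 0 = 0.
  apply/eqP; rewrite eq_le SF ?andbT; last by rewrite /S /= scale0r subr0.
  apply/ler_addgt0Pr => e e0; rewrite add0r; apply: FS.
  rewrite /S /= sub0r => /MU.
  by rewrite opprK; apply; exact: wU.2.
have FN y : F (- y) = - F y.
  apply/eqP; rewrite eq_le; apply/andP; split.
    by have := F_super y (- y); rewrite subrr F0; lra.
  apply/ler_addgt0Pr => e e0.
  suff /SF : S (- y) (- F y - e) by lra.
  (* Otherwise totality puts [y - (F y + e) *: u] in [M], against the definition of [F y]. *)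
  have [|] := Mtot (- y - (- F y - e) *: u); first by [].
  rewrite opprB opprK [_ + y]addrC -opprD scaleNr -/(S y (F y + e)) => Sy.
  by have := SF y (F y + e) Sy; lra.
have FD x y : F (x + y) = F x + F y.
  apply/eqP; rewrite eq_le F_super andbT.
  by have := F_super (x + y) (- y); rewrite addrK FN; lra.
have FZ_ge (t : R) y : 0 < t -> t * (F y : R) <= F (t *: y).
  move=> t0; rewrite mulrC -ler_pdivlMr//.
  apply/ler_addgt0Pr => e e0; rewrite -lerBlDr.
  rewrite ler_pdivlMr// mulrC; apply: SF.
  rewrite /S /= -scalerA -scalerBr; apply: MZ => //.
  by apply: ltFS; rewrite ltrBlDr ltrDl.
have FZp (t : R) y : 0 < t -> F (t *: y) = t * (F y : R).
  move=> t0; apply/eqP; rewrite eq_le FZ_ge// andbT.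
  have := FZ_ge t^-1 (t *: y); rewrite invr_gt0 scalerA mulVf ?gt_eqF// scale1r.
  by move=> /(_ t0); rewrite mulrC ler_pdivrMr// mulrC.
have FZ (t : R) y : F (t *: y) = t * (F y : R).
  have [t0|t0|->] := ltrgt0P t; first exact: FZp; last first.
    by rewrite scale0r mul0r F0.
  have := FZp (- t) y; rewrite oppr_gt0 scaleNr FN mulNr => /(_ t0).
  exact: oppr_inj.
have Flin : linear (F : V -> R^o) by move=> t x y; rewrite FD FZ.
pose G : {linear V -> R^o} :=
  HB.pack F (GRing.isLinear.Build R V R^o *:%R F Flin).
exists G => x Ux; change (0 < F x).
(* Openness towards [- u] leaves room [e], whence [e <= F x]. *)
have [e e0 Ue] := Uopen x (- u) Ux.
apply: (lt_le_trans e0); apply: SF; rewrite /S /=.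
by rewrite -scalerN; exact: UM.
Qed.

(** * Interiors and continuity in a topological linear space *)

Lemma cvg_scaleD {R : realType} {Y : topologicalLmodType R} {T : Type}
  {G : set_system T} {FG : Filter G} {a : T -> R^o} {g h : T -> Y}
  {t : R^o} {y z : Y} :
  a w @[w --> G] --> t -> g w @[w --> G] --> y -> h w @[w --> G] --> z ->
  a w *: g w + h w @[w --> G] --> t *: y + z.
Proof.
move=> at_ gy; apply: (@continuous2_cvg _ _ _ _ _ _ _ _ (fun p q : Y => p + q)).
  exact: (@add_continuous Y (t *: y, z)).
apply: (@continuous2_cvg _ _ _ _ _ _ _ _
  (fun (p : R^o) (q : Y) => p *: q)) => //.
exact: (@scale_continuous R Y (t, y)).
Qed.

(** The inverse affine map is continuous and pulls a neighbourhood of [y] inside [S] back to one of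
    the image point. *)
Lemma interior_affine {R : realType} {Y : topologicalLmodType R} {S S' : set Y}
  {t : R} {z y : Y} : t != 0 -> (forall s, S s -> S' (t *: s + z)) ->
  S° y -> S'° (t *: y + z).
Proof.
move=> t0 SS' Sy.
have : t^-1 *: w - t^-1 *: z @[w --> t *: y + z] -->
    t^-1 *: (t *: y + z) - t^-1 *: z.
  by apply: cvg_scaleD; [exact: cvg_cst|exact: cvg_id|exact: cvg_cst].
rewrite scalerDr scalerA mulVf// scale1r addrK => /(_ S Sy) nS.
have {}nS : \forall w \near t *: y + z, S (t^-1 *: w - t^-1 *: z) by exact: nS.
change (\forall w \near t *: y + z, S' w); near=> w.
have /SS' : S (t^-1 *: w - t^-1 *: z) by near: w.
by rewrite scalerDr scalerN !scalerA divff// !scale1r subrK.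
Unshelve. all: by end_near. Qed.

(** Continuity of [e |-> x + e *: y] at 0; this supplies the openness hypothesis of
    [exists_pos_linear]. *)
Lemma interior_absorb {R : realType} {Y : topologicalLmodType R} {S : set Y}
  {x : Y} (y : Y) : S° x -> exists2 e : R, 0 < e & S° (x + e *: y).
Proof.
move=> /nbhs_interior Sx.
have : e *: y + x @[e --> (0 : R^o)] --> 0 *: y + x.
  by apply: cvg_scaleD; [exact: cvg_id|exact: cvg_cst|exact: cvg_cst].
rewrite scale0r add0r => /(_ _ Sx) /nbhs_ballP[e /= e0 eS].
exists (e / 2); first by rewrite divr_gt0.
rewrite addrC; apply: eS; rewrite /ball /= sub0r normrN ger0_norm; lra.
Qed.

(** For [w] near [x] both points [u ± d^-1 *: (w - x)] lie in [S], so nonnegativity of [F] there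
    bounds [|F w - F x|] by [d * F u]. *)
Lemma continuous_pos_solid {R : realType} {Y : topologicalLmodType R}
  {S : set Y} {F : {linear Y -> R^o}} :
  solid S -> (forall y, S y -> 0 <= (F y : R)) -> continuous (F : Y -> R^o).
Proof.
move=> [u Su] F0 x; apply/cvg_ballP => e e0.
have [d d0 dFu] : exists2 d : R, 0 < d & d * (F u : R) < e.
  have Fu : 0 <= (F u : R) by apply: F0; exact: interior_subset Su.
  (* The summand 1 covers the case [F u = 0]. *)
  exists (e / (F u + 1)); first by rewrite divr_gt0 ?ltr_wpDl.
  by rewrite mulrAC ltr_pdivrMr ?ltr_wpDl// ltr_pM2l// ltrDl.
have near_side (s : R) : s != 0 -> \forall w \near x, S (u + s *: (w - x)).
  move=> s0.
  (* This set contains the image of [S] under an affine map sending [u] to [x]. *)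
  have : ([set w | S (u + s *: (w - x))])° (s^-1 *: u + (x - s^-1 *: u)).
    apply: (@interior_affine _ _ S) Su; first by rewrite invr_eq0.
    move=> w Sw /=; rewrite [x - _]addrC addrA addrK scalerDr scalerN !scalerA.
    by rewrite divff// !scale1r addrC subrK.
  by rewrite addrC subrK.
have dn0 : d^-1 != 0 by rewrite invr_eq0 gt_eqF.
have Nd : - d^-1 != 0 by rewrite oppr_eq0.
have FE (s : R) w : F (u + s *: (w - x)) = F u + s * (F w - F x : R) :> R.
  by rewrite linearD linearZ/= linearB.
near=> w.
have /F0 : S (u + d^-1 *: (w - x)) by near: w; exact: near_side.
have /F0 : S (u + (- d^-1) *: (w - x)) by near: w; exact: near_side.
rewrite /ball /= !FE => h1 h2; apply: le_lt_trans dFu.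
have {}h1 : 0 <= d * (F u + - d^-1 * (F w - F x : R))
  by rewrite mulr_ge0 ?(ltW d0).
have {}h2 : 0 <= d * (F u + d^-1 * (F w - F x : R))
  by rewrite mulr_ge0 ?(ltW d0).
rewrite mulrDr mulrA mulrN divff ?gt_eqF// in h1.
rewrite mulrDr mulrA divff ?gt_eqF// in h2.
by rewrite ler_norml; apply/andP; split; lra.
Unshelve. all: by end_near. Qed.

(** An interior point [y] stays in the half-space when moved by [- e *: u], so
    [F y >= e * F u > 0]. *)
Lemma interior_Cpsi0 {R : realType} {Y : topologicalLmodType R} (psi : Y -> R)
  {F : {linear Y -> R^o}} (u : Y) :
  continuous (F : Y -> R^o) -> 0 < (F u : R) ->
  (Cpsi psi F 0)° = [set y | 0 < (F y : R)].
Proof.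
move=> Fc Fu; apply/seteqP; split=> y.
  move=> /(interior_absorb (- u))[e e0 /interior_subset].
  rewrite /Cpsi /= mul0r scalerN linearB linearZ/= subr_ge0.
  by apply: lt_le_trans; rewrite mulr_gt0.
have Fo : open [set y | 0 < (F y : R)].
  by apply: (@open_comp _ _ F [set r : R^o | 0 < r]) => //; exact: open_gt.
move: y; rewrite -/(_ `<=` _) -open_subsetE// => z /= /ltW.
by rewrite /Cpsi /= mul0r.
Qed.

(** * Convex cones and their separation *)

Lemma cone_scale {R : realType} {Y : topologicalLmodType R} {K : set Y}
  {t : R} {x : Y} : is_cone K -> 0 <= t -> K x -> K (t *: x).
Proof. by move=> [_ KE] t0 Kx; rewrite KE; exists t => //; exists x. Qed.

Lemma cone_add {R : realType} {Y : topologicalLmodType R} {K : set Y}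
  {x y : Y} : is_cone K -> convex_set K -> K x -> K y -> K (x + y).
Proof.
move=> Kcone Kc Kx Ky.
have h0 : 0 <= (2^-1 : R) by rewrite invr_ge0.
have h1 : (2^-1 : R) <= 1 by lra.
have /set_mem Kxy := Kc x y (Itv01 h0 h1) (mem_set Kx) (mem_set Ky).
have {}Kxy : K (2^-1 *: x + (1 - 2^-1) *: y) by exact: Kxy.
have := cone_scale Kcone (ler0n _ 2) Kxy.
rewrite scalerDr !scalerA mulrBr mulr1 divff ?pnatr_eq0//.
by rewrite -addrA subrr addr0 !scale1r.
Qed.

Lemma interior_coneZ {R : realType} {Y : topologicalLmodType R} {K : set Y}
  {t : R} {x : Y} : is_cone K -> 0 < t -> K° x -> K° (t *: x).
Proof.
move=> Kcone t0 Kx; rewrite -[t *: x]addr0.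
apply: interior_affine Kx; first by rewrite gt_eqF.
by move=> s Ks; rewrite addr0; exact: cone_scale (ltW t0) Ks.
Qed.

Lemma interior_coneD {R : realType} {Y : topologicalLmodType R} {K : set Y}
  {x y : Y} : is_cone K -> convex_set K -> K° x -> K y -> K° (x + y).
Proof.
move=> Kcone Kc Kx Ky; rewrite -[x]scale1r.
apply: interior_affine Kx; first exact: oner_neq0.
by move=> s Ks; rewrite scale1r; exact: cone_add.
Qed.

Lemma interior_cone0 {R : realType} {Y : topologicalLmodType R} {K : set Y} :
  is_cone K -> K° 0 -> K = setT.
Proof.
move=> Kcone K0; apply/seteqP; split=> // y _.
have [e e0] := interior_absorb y K0; rewrite add0r => /interior_subset Ky.
have ei0 : 0 <= e^-1 by rewrite invr_ge0 ltW.
by have := cone_scale Kcone ei0 Ky; rewrite scalerA mulVf ?gt_eqF// scale1r.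
Qed.

Lemma convex_cone_separation {R : realType} {Y : topologicalLmodType R}
  {A K : set Y} :
  is_cone A -> convex_set A -> is_cone K -> convex_set K -> solid K ->
  (forall y, A y -> ~ K° (- y)) ->
  exists F : {linear Y -> R^o}, [/\ continuous (F : Y -> R^o),
    forall y, A y -> 0 <= (F y : R) & forall y, K° y -> 0 < (F y : R)].
Proof.
move=> Acone Ac Kcone Kc [k Kk] AK.
pose U := [set a + b | a in A & b in K°].
have A0 : A 0 by exact: Acone.1.
have KU y : K° y -> U y by move=> Ky; exists 0 => //; exists y; rewrite ?add0r.
have [||y z|F F0] := @exists_pos_linear R Y U k _ _ (KU _ Kk).
- split=> [_ _ [a Aa [b Kb <-]] [c Ac' [d Kd <-]]|t _ t0 [a Aa [b Kb <-]]].
    exists (a + c); first exact: cone_add.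
    exists (b + d); last by rewrite addrACA.
    by apply: interior_coneD => //; exact: interior_subset.
  exists (t *: a); first exact: cone_scale (ltW t0) Aa.
  by exists (t *: b); [exact: interior_coneZ|rewrite scalerDr].
- move=> [a Aa [b Kb /eqP]]; rewrite addrC addr_eq0 => /eqP bE.
  by apply: (AK a) => //; rewrite -bE.
- move=> [a Aa [b Kb <-]]; have [e e0 Ke] := interior_absorb z Kb.
  by exists e => //; exists a => //; exists (b + e *: z); rewrite ?addrA.
have FK y : K° y -> 0 < (F y : R) by move=> /KU /F0.
exists F; split=> //.
  apply: (@continuous_pos_solid _ _ K°).
    by exists k; apply/nbhs_interior.
  by move=> y /FK /ltW.
(* The multiple of [k] is chosen to have [F]-value [e], so [F a + e > 0] for every [e > 0]. *)
move=> a Aa; apply/ler_addgt0Pl => e e0.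
have Fk := FK _ Kk.
have /F0 : U (a + (e / F k) *: k).
  exists a => //; exists ((e / F k) *: k) => //.
  by apply: interior_coneZ => //; rewrite divr_gt0.
by rewrite linearD linearZ/= /GRing.scale/= divfK ?gt_eqF// addrC => /ltW.
Qed.

Lemma conical_is_cone {R : realType} {Y : topologicalLmodType R} {D : set Y} :
  D !=set0 -> is_cone (conical D).
Proof.
move=> [d Dd]; split.
  by exists 0; rewrite //=; exists d; rewrite ?scale0r.
apply/seteqP; split=> [y Dy|_ [t /= t0 [_ [s /= s0 [z Dz <-]] <-]]].
  by exists 1; rewrite /=; last by exists y => //; rewrite scale1r.
by exists (t * s); [exact: mulr_ge0|exists z; rewrite // scalerA].
Qed.

(** * Scalarization at a weakly efficient point *)

Theorem corollary30 (R : realType) (X Y : topologicalLmodType R)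
  (Omega : set X) (Omega_neq0 : Omega !=set0) (f : X -> Y)
  (psi : Y -> R) (psi_seminorm : seminorm psi)
  (K : set Y) (K_cone : is_cone K) (K_nontrivial : nontrivial K)
  (K_solid : solid K) (K_convex : convex_set K)
  (AA : X -> set Y)
  (AA_def :
     (forall x, Omega x ->
        AA x = conical [set f w - f x | w in Omega]) \/
     (forall x, Omega x ->
        AA x = conical [set f w + k - f x | w in Omega & k in K]))
  (xb : X) (xb_WEff : WEff Omega f K xb)
  (A_nontrivial : nontrivial (AA xb)) (A_convex : convex_set (AA xb))
  (K_base : normlike_base K psi) (A_base : normlike_base (AA xb) psi)
  (S_solid : solid (base_hull (oppset K) psi)) :
  exists (xs : {linear Y -> R^o}) (alpha : R),
    augmented_dual K psi (xs, alpha) /\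
    let C := Cpsi psi xs alpha in
    WEff Omega f C xb /\
    (C° !=set0 ->
     forall phi : Y -> R, sublinear phi -> phi 0 = 0 -> representing C phi ->
     [/\ (* (i) *)
         forall k, C° k -> P_solution Omega f phi (f xb) k (xb, 0),
         (* (ii) *)
         (strictly_representing C phi ->
            argmin Omega (fun x => phi (f x - f xb)) xb) /\
         (phi = phi_sep psi xs alpha -> Cpsi_strict psi xs alpha !=set0 ->
            strictly_representing C phi),
         (* (iii) *)
         forall (PP TT : set Y) (RR : set R), TT `<=` C° ->
           f @` WEff Omega f C `<=`
             [set a + v | a in PP & v in [set s *: k | s in RR & k in TT]] ->
           exists a k s, [/\ PP a, TT k, RR s &
             P_solution Omega f phi a k (xb, s)] &
         (* (iv) *)
         forall (PP TT : set Y) (RR : set R), TT `<=` C° ->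
           f @` WEff Omega f C `<=`
             [set a + v | a in PP & v in [set s *: k | s in RR & k in TT]] ->
           closed C -> nontrivial C ->
           exists a k s, [/\ PP a, TT k, RR s,
             s%:E = phiG C a k (f xb) &
             is_min [set phiG C a k (f x) | x in Omega] s%:E]]).
Proof.
have [Oxb nxb] := xb_WEff.
have K0 : K 0 by exact: K_cone.1.
(* [D] treats both forms of [AA] at once: in the first one, [k = 0]. *)
have [D [AE D0 OD DO]] : exists D : set Y, [/\ AA xb = conical D, D !=set0,
    forall w, Omega w -> D (f w - f xb) &
    forall d, D d -> exists w k, [/\ Omega w, K k & d = f w + k - f xb]].
  case: AA_def => AE.
  - exists [set f w - f xb | w in Omega]; split; first exact: AE.
    + by exists (f xb - f xb); exists xb.
    + by move=> w Ow; exists w.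
    + by move=> _ [w Ow <-]; exists w, 0; rewrite addr0.
  - exists [set f w + k - f xb | w in Omega & k in K].
    have OD w : Omega w ->
        [set f w + k - f xb | w in Omega & k in K] (f w - f xb).
      by move=> Ow; exists w => //; exists 0; rewrite ?addr0.
    split; [exact: AE| |exact: OD|].
    + by exists (f xb - f xb); exact: OD.
    + by move=> _ [w Ow [k Kk <-]]; exists w, k.
have Acone : is_cone (AA xb) by rewrite AE; exact: conical_is_cone.
(* For [y = t *: d], the case [t = 0] would put 0 in the interior of [K], forcing [K = Y]. Otherwise
   rescale to [t = 1] and add [k]: then [f xb - f w] is interior to [K], against weak efficiency. *)
have AK y : AA xb y -> ~ K° (- y).
  rewrite AE => -[t /= t0 [d /DO[w [k [Ow Kk ->]]] <-]].
  move: t0; rewrite le_eqVlt => /orP[/eqP<-|t0].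
    by rewrite scale0r oppr0 => /(interior_cone0 K_cone); exact: K_nontrivial.2.
  have ti0 : 0 < t^-1 by rewrite invr_gt0.
  move=> /(interior_coneZ K_cone ti0).
  rewrite scalerN scalerA mulVf ?gt_eqF// scale1r => Kd.
  have := interior_coneD K_cone K_convex Kd Kk.
  rewrite addrAC opprD subrK => KN.
  by apply: nxb; exists w => //; exists (- (f w - f xb)) => //;
    rewrite opprK addrC subrK.
have [F [Fc FA FK]] :=
  convex_cone_separation Acone A_convex K_cone K_convex K_solid AK.
have Fmin x : Omega x -> (F (f xb) : R) <= F (f x).
  move=> Ox; rewrite -subr_ge0 -linearB; apply: FA; rewrite AE.
  by exists 1 => //=; exists (f x - f xb); [exact: OD|rewrite scale1r].
have [k0 Kk0] := K_solid.
have intC : (Cpsi psi F 0)° = [set y | 0 < (F y : R)].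
  exact: interior_Cpsi0 (FK _ Kk0).
exists F, 0; split.
  by split=> // y /FK /=; rewrite mul0r subr0.
move=> C.
have CE y : C y = (0 <= (F y : R)) by rewrite /C /Cpsi /= mul0r.
have WxbC : WEff Omega f C xb.
  split=> // -[x Ox [c]]; rewrite intC /= => Fc0 fx.
  by have := Fmin x Ox; rewrite -fx linearB lerBrDr gerDl leNgt Fc0.
split=> // _ phi _ phi0 Cphi.
have phiE y : (phi y <= 0) = ((F y : R) <= 0).
  have phiP : (phi y <= 0) = oppset C y :> Prop by rewrite Cphi.
  apply/idP/idP => [|Fy].
    by rewrite phiP => -[c]; rewrite CE => Fc0 <-; rewrite linearN oppr_le0.
  by rewrite phiP; exists (- y); rewrite ?opprK// CE linearN oppr_ge0.
(* Feasibility of [(x, l)] means [F (f x) <= F a + l * F k], while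
   [F (f x) >= F (f xb) = F a + s * F k]; divide by [F k]. This serves (i) with [s = 0], and
   (iii). *)
have sol a k s : 0 < (F k : R) -> f xb = a + s *: k ->
    P_solution Omega f phi a k (xb, s).
  move=> Fk fxb; split; first by split; rewrite //= fxb addrAC addrK subrr phi0.
  move=> [x l] [/= Ox]; rewrite phiE !linearB linearZ/= => Fx.
  have := Fmin x Ox; rewrite fxb linearD linearZ/= => Fx'.
  rewrite -(ler_pM2r Fk); move: Fx Fx'; rewrite /GRing.scale/=; lra.
(* The same comparison, with [F c >= 0] replacing feasibility; [phiG_le] attains the bound at [xb]
   with [c = 0]. *)
have phiG_ge a k s x : 0 < (F k : R) -> f xb = a + s *: k -> Omega x ->
    (s%:E <= phiG C a k (f x))%E.
  move=> Fk fxb Ox; apply: le_ereal_inf_tmp => _ [t /= [c Cc fx] <-].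
  rewrite lee_fin -(ler_pM2r Fk).
  have := Fmin x Ox; rewrite fxb -fx !linearD linearN !linearZ/=.
  move: Cc; rewrite CE /GRing.scale/=; lra.
have phiG_le a k s : f xb = a + s *: k -> (phiG C a k (f xb) <= s%:E)%E.
  move=> fxb; apply: ereal_inf_lbound; exists s => //=; exists 0.
    by rewrite CE linear0.
  by rewrite subr0 addrC.
have decomp (PP TT : set Y) (RR : set R) : TT `<=` C° ->
    f @` WEff Omega f C `<=`
      [set a + v | a in PP & v in [set s *: k | s in RR & k in TT]] ->
    exists a k s, [/\ PP a, TT k, RR s, 0 < (F k : R) & f xb = a + s *: k].
  move=> TC sub; have [a Pa [_ [s Rs [k Tk <-]] fxb]] := sub _ (imageP f WxbC).
  by exists a, k, s; split=> //; have := TC _ Tk; rewrite intC.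
split.
- move=> k; rewrite intC => Fk; apply: sol => //.
  by rewrite scale0r addr0.
- split=> [[_ intphi]|phi_def _].
    (* A negative value would place [f xb - f x] in the interior of [C], that is,
       [F (f x) < F (f xb)]. *)
    split=> // x Ox; rewrite subrr phi0 leNgt; apply/negP => phix.
    have : [set y | phi y < 0] (f x - f xb) by [].
    rewrite -intphi => -[c]; rewrite intC /= => Fc0 cE.
    have := Fmin x Ox; rewrite -subr_ge0 -linearB -cE linearN oppr_ge0.
    by rewrite leNgt Fc0.
  split=> //; rewrite intC phi_def; apply/seteqP; split=> y /=.
    by move=> [c Fc0 <-]; rewrite /phi_sep mul0r addr0 linearN oppr_lt0.
  by rewrite /phi_sep mul0r addr0 => Fy; exists (- y);
    rewrite ?opprK//= linearN oppr_gt0.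
- move=> PP TT RR TC /(decomp _ _ _ TC)[a [k [s [Pa Tk Rs Fk fxb]]]].
  by exists a, k, s; split=> //; exact: sol.
- move=> PP TT RR TC /(decomp _ _ _ TC)[a [k [s [Pa Tk Rs Fk fxb]]]] _ _.
  have sE : s%:E = phiG C a k (f xb).
    by apply/eqP; rewrite eq_le phiG_le// andbT phiG_ge.
  exists a, k, s; split=> //; split; first by exists xb.
  by move=> _ [x Ox <-]; exact: phiG_ge.
Qed.
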